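(* Let $D$ be a weakly locally finite division ring with center $F$ and let $K$ be a proper division subring of $D$. Then every normal subgroup $N$ of $D^*$ which is radical over $K$ (i.e. for each $x\in N$ there is a positive integer $n$ with $x^n\in K$) is contained in $F$.
   Context: A division ring $D$ is weakly locally finite if for every finite subset $S\subseteq D$, the division subring generated by $S$ is finite dimensional over its own center. *)

(* Defs.v *)
From HB Require Import structures.
From mathcomp Require Import all_boot all_order all_algebra.
Set Implicit Arguments. Unset Strict Implicit. Unset Printing Implicit Defensive.
Import GRing.Theory.
Local Open Scope ring_scope.

Definition is_division_ring (D : unitRingType) : Prop :=
  forall x : D, x != 0 -> x \is a GRing.unit.

Definition is_divsubring (D : unitRingType) (A : D -> Prop) : Prop :=
  [/\ A 1,
      (forall x y, A x -> A y -> A (x - y)),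
      (forall x y, A x -> A y -> A (x * y)) &
      (forall x, A x -> x != 0 -> A x^-1)].

Definition divsubring_gen (D : unitRingType) (S : seq D) : D -> Prop :=
  fun x => forall A : D -> Prop, is_divsubring A -> (forall s, s \in S -> A s) -> A x.

Definition center_of (D : unitRingType) (A : D -> Prop) : D -> Prop :=
  fun x => A x /\ forall y, A y -> x * y = y * x.

Definition fin_dim_over_center (D : unitRingType) (A : D -> Prop) : Prop :=
  exists b : seq D, (forall v, v \in b -> A v) /\
    forall x, A x -> exists c : seq D,
      size c = size b /\ (forall a, a \in c -> center_of A a) /\
      x = \sum_(i < size b) c`_i * b`_i.

Definition weakly_locally_finite (D : unitRingType) : Prop :=
  forall S : seq D, fin_dim_over_center (divsubring_gen S).

Definition is_normal_subgroup_units (D : unitRingType) (N : D -> Prop) : Prop :=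
  [/\ (forall x, N x -> x != 0),
      N 1,
      (forall x y, N x -> N y -> N (x * y)),
      (forall x, N x -> N x^-1) &
      (forall x y, N x -> y != 0 -> N (y^-1 * x * y))].

Definition radical_over (D : unitRingType) (N K : D -> Prop) : Prop :=
  forall x, N x -> exists n : nat, (0 < n)%N /\ K (x ^+ n).

Definition ring_center (D : unitRingType) : D -> Prop :=
  fun x => forall y, x * y = y * x.

(* Main.v *)
(** Let [w] be a power of [x] in [N] such that [w] and its conjugates by [y] and
    [1 + y] lie in [K]; comparing them shows that [y] lies in [K] or commutes
    with [w].  Since [K] is proper, every element of [N] thus has, for every [y]
    in [D], a power commuting with [y].  So let [a] be in [N], [b] in [D], and
    let [E] be the division subring generated by [a] and [b]: it is finite
    dimensional over its center, and every element of [N] in [E] has a power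
    central in [E].

    By finite dimensionality [E] is finite dimensional over a finitely generated
    central subfield.  If that field is finite, Wedderburn's theorem applies.
    Otherwise it is finite over Q or over some k(t), and the 3-adic, resp.
    t-adic, valuation provides an order [R] in [E], separated for a central
    element [pi], with [E = R[1/pi]].  In [1 + pi R] roots of order prime to
    the characteristic are unique, even between noncommuting elements.  Apply
    this to the commutator [z] of [1 + pi^J b] and [a]: it belongs to [N], and
    for large [J] it and its conjugates by [a] and [b] lie in [1 + pi R], hence
    a power [z^q], with [q] a power of the characteristic exponent, is central.
    A noncentral [w] in [N] with [w^p] central in characteristic [p] would
    satisfy [w y w^-1 = y + 1] for some [y], and root uniqueness excludes this
    too; so [z] is central.  Then [z] is a root of unity in [1 + pi R], so
    [z = 1], and [a] commutes with [b]. *)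

From HB Require Import structures.
Require Import Defs.
From mathcomp Require Import all_boot all_order all_algebra all_field.
From mathcomp Require Import boolp zify.
Set Implicit Arguments. Unset Strict Implicit. Unset Printing Implicit Defensive.
Import GRing.Theory.
Local Open Scope ring_scope.

(** * Division subrings as types: fields and Wedderburn's theorem *)

Section SubTypes.
Variables (D : unitRingType) (hD : is_division_ring D).

Lemma divsubring_inv (A : D -> Prop) x : is_divsubring A -> A x -> A x^-1.
Proof.
move=> [A1 Asub Amul Ainv] Ax; case: (eqVneq x 0) => [x0|]; last exact: Ainv.
by rewrite x0 invr0 -x0.
Qed.

Lemma divsubring_divring_closed (A : D -> Prop) (P : {pred D}) :
  is_divsubring A -> (forall x, reflect (A x) (x \in P)) -> divring_closed P.
Proof.
move=> hA AP; have [A1 Asub Amul Ainv] := hA.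
split=> [|x y /AP Ax /AP Ay|x y /AP Ax /AP Ay]; apply/AP => //; first exact: Asub.
exact: Amul (divsubring_inv _ _).
Qed.

(** Polynomials and matrices need a [fieldType], so a commutative division subring is packed as one;
    [f] is its inclusion into [D]. *)
Lemma field_of_divsubring (k : D -> Prop) :
  is_divsubring k -> (forall x y, k x -> k y -> x * y = y * x) ->
  exists (kT : fieldType) (f : {rmorphism kT -> D}),
    forall x, k x <-> exists y, f y = x.
Proof.
move=> hk kC.
pose P : {pred D} := fun x => `[<k x>].
have PP x : reflect (k x) (x \in P) by exact: asboolP.
have cP := divsubring_divring_closed hk PP.
pose T1 : unitRingType := HB.pack {x : D | P x}
  (GRing.SubChoice_isSubUnitRing.Build D P {x : D | P x} cP).
have valM : {morph (val : T1 -> D) : x y / x * y} by [].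
have val0 : val (0 : T1) = 0 by [].
have T1C : commutative (@GRing.mul T1).
  by move=> x y; apply: val_inj; rewrite !valM; apply: kC; apply/PP; apply: valP.
pose T2 : comUnitRingType := HB.pack T1 (GRing.PzRing_hasCommutativeMul.Build T1 T1C).
have T2F : GRing.field_axiom T2.
  move=> x xN0; have vN0 : val x != 0 by apply: contraNneq xN0 => v0; apply/eqP; apply: val_inj.
  have Pv : P (val x)^-1 by apply/PP/(divsubring_inv hk)/PP/valP.
  apply/unitrP; exists (exist (fun x => P x) _ Pv : T1).
  by split; apply: val_inj; rewrite valM /= ?mulVr ?mulrV //; apply: hD.
pose T3 : fieldType := HB.pack T2 (GRing.ComUnitRing_isField.Build T2 T2F).
have fB : zmod_morphism (val : T3 -> D) by [].
have fM : monoid_morphism (val : T3 -> D) by [].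
pose f : {rmorphism T3 -> D} := HB.pack (val : T3 -> D)
  (GRing.isZmodMorphism.Build T3 D _ fB) (GRing.isMonoidMorphism.Build T3 D _ fM).
exists T3, f => x; split=> [kx|[y <-]]; last by apply/PP/valP.
have Px : P x by apply/PP.
by exists (exist (fun x => P x) _ Px : T1).
Qed.

(** Wedderburn's little theorem, in the form [finDomain_mulrC], on the finite subtype of [D] cut out
    by a list. *)
Lemma finite_divsubring_comm (E : D -> Prop) (s : seq D) :
  is_divsubring E -> (forall x, E x -> x \in s) ->
  forall x y, E x -> E y -> x * y = y * x.
Proof.
move=> hE Es x y Ex Ey.
(* [s] may also hold elements outside [E]; filtering leaves exactly [E]. *)
pose t := [seq z <- s | `[<E z>]].
have tP z : reflect (E z) (z \in t).
  rewrite mem_filter; apply: (iffP andP) => [[/asboolP]|Ez] //.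
  by split; [apply/asboolP | apply: Es].
have ct : divring_closed (mem t).
  by apply: (divsubring_divring_closed hE) => z; apply: tP.
pose T1 : finUnitRingType := HB.pack (seq_sub t)
  (GRing.SubChoice_isSubUnitRing.Build D (mem t) (seq_sub t) ct).
have domT : GRing.integral_domain_axiom T1.
  move=> u v uv0; have {uv0}: val u * val v = 0 by rewrite -[0]/(val (0 : T1)) -uv0.
  have val0 w : val w = 0 -> w = 0 :> T1 by move=> w0; apply: val_inj.
  case: (eqVneq (val u) 0) => [/val0->|/hD Uu]; first by rewrite eqxx.
  by move/eqP; rewrite mulrI_eq0; [move/eqP/val0->; rewrite eqxx orbT|apply: mulrI].
move/(congr1 val): (finDomain_mulrC domT
  (SeqSub (introT (tP x) Ex)) (SeqSub (introT (tP y) Ey))).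
done.
Qed.

End SubTypes.

(** * Subrings, generated division subrings and linear spans *)

Section Subrings.
Variables (D : unitRingType) (hD : is_division_ring D).
Implicit Types (A B E k : D -> Prop) (x y z : D) (e S : seq D).

Definition is_subring A : Prop :=
  [/\ A 1, forall x y, A x -> A y -> A (x - y)
    & forall x y, A x -> A y -> A (x * y)].

Lemma divsubring_subring A : is_divsubring A -> is_subring A.
Proof. by case. Qed.

Lemma subring0 A : is_subring A -> A 0.
Proof. by case=> A1 AB _; rewrite -(subrr 1); apply: AB. Qed.

Lemma subringN A x : is_subring A -> A x -> A (- x).
Proof. by move=> hA Ax; rewrite -sub0r; case: (hA) => _ AB _; apply: AB; first apply: subring0. Qed.

Lemma subringD A x y : is_subring A -> A x -> A y -> A (x + y).
Proof.
by move=> hA Ax Ay; rewrite -[y]opprK; case: (hA) => _ AB _; apply: AB => //; apply: subringN.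
Qed.

Lemma subringM A x y : is_subring A -> A x -> A y -> A (x * y).
Proof. by case=> _ _; apply. Qed.

Lemma subringX A x n : is_subring A -> A x -> A (x ^+ n).
Proof.
move=> hA Ax; elim: n => [|n IHn]; first by case: hA.
by rewrite exprS; apply: subringM.
Qed.

Lemma subring_sum A (I : Type) (r : seq I) (P : pred I) (F : I -> D) :
  is_subring A -> (forall i, P i -> A (F i)) -> A (\sum_(i <- r | P i) F i).
Proof.
by move=> hA AF; apply: big_ind => //; [apply: subring0|move=> *; apply: subringD].
Qed.

Lemma subring_nat A n : is_subring A -> A n%:R.
Proof.
move=> hA; elim: n => [|n IHn]; first exact: subring0.
by rewrite mulrS; apply: subringD => //; case: hA.
Qed.

Lemma divring_mul_eq0 x y : x * y = 0 -> x = 0 \/ y = 0.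
Proof.
move=> xy0; have [->|/hD Ux] := eqVneq x 0; [by left | right].
by apply: (mulrI Ux); rewrite xy0 mulr0.
Qed.

Lemma divring_expr_neq0 x n : x != 0 -> x ^+ n != 0.
Proof. by move=> /hD Ux; apply/negP => /eqP X0; move: (unitrX n Ux); rewrite X0 unitr0. Qed.

Lemma divsubring_gen_divsubring S : is_divsubring (divsubring_gen S).
Proof.
split=> [A|x y gx gy A|x y gx gy A|x gx xN0 A] hA SA; case: (hA) => A1 AB AM AV //.
- by apply: AB; [apply: gx|apply: gy].
- by apply: AM; [apply: gx|apply: gy].
- by apply: AV => //; apply: gx.
Qed.

Lemma mem_divsubring_gen S x : x \in S -> divsubring_gen S x.
Proof. by move=> Sx A _; apply. Qed.

Lemma sub_divsubring_gen S A :
  is_divsubring A -> (forall x, x \in S -> A x) -> forall x, divsubring_gen S x -> A x.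
Proof. by move=> hA SA x; apply. Qed.

Lemma comm_divsubring A : is_divsubring (fun x => forall y, A y -> x * y = y * x).
Proof.
split=> [y _|x y cx cy z Az|x y cx cy z Az|x cx xN0 z Az].
- by rewrite mul1r mulr1.
- by rewrite mulrBl mulrBr cx ?cy.
- by rewrite -mulrA cy // mulrA cx // mulrA.
- by apply/commr_sym/commrV/commr_sym/cx.
Qed.

(** The centralizer of [x] is a division subring, so once it contains [S] it contains all that [S]
    generates. *)
Lemma comm_divsubring_gen S x :
  (forall s, s \in S -> x * s = s * x) ->
  forall y, divsubring_gen S y -> x * y = y * x.
Proof.
move=> cS y gy; apply/esym.
apply: (sub_divsubring_gen (comm_divsubring (fun z => z = x)) _ gy) => // s Ss _ ->.
by apply/esym/cS.
Qed.

Lemma center_divsubring E : is_divsubring E -> is_divsubring (center_of E).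
Proof.
move=> hE; have [E1 EB EM EV] := hE; have [C1 CB CM CV] := comm_divsubring E.
split=> [|x y [Ex cx] [Ey cy]|x y [Ex cx] [Ey cy]|x [Ex cx] xN0]; split.
- exact: E1.
- exact: C1.
- exact: EB.
- exact: CB.
- exact: EM.
- exact: CM.
- exact: EV.
- exact: CV.
Qed.

(** The coefficients form an arbitrary predicate [k], so that vector spaces over a field and
    lattices over an order are treated alike. *)
Fixpoint lspan k e y : Prop :=
  if e is x :: e' then exists a z, [/\ k a, lspan k e' z & y = a * x + z] else y = 0.

Lemma lspanP k e y : lspan k e y <->
  exists c : nat -> D, (forall i, (i < size e)%N -> k (c i)) /\ y = \sum_(i < size e) c i * e`_i.
Proof.
elim: e y => [|x e IHe] y /=.
  split=> [->|[c [_ ->]]]; last by rewrite big_ord0.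
  by exists (fun=> 0); rewrite big_ord0.
split=> [[a [z [ka /IHe [c [kc ->]] ->]]]|[c [kc ->]]].
  exists (fun i => if i is j.+1 then c j else a); rewrite big_ord_recl /=; split=> //.
  by case=> // i; apply: kc.
rewrite big_ord_recl /=; exists (c 0%N), (\sum_(i < size e) c i.+1 * e`_i).
by split=> //; [apply: kc|apply/IHe; exists (fun i => c i.+1); split=> // i; apply: (kc i.+1)].
Qed.

Lemma lspan_ind k e (P : D -> Prop) : P 0 ->
  (forall a x z, k a -> x \in e -> P z -> P (a * x + z)) ->
  forall y, lspan k e y -> P y.
Proof.
move=> P0; elim: e => [|x e IHe] PS y /=; first by move=> ->.
move=> [a [z [ka ez ->]]]; apply: (PS) => //; first exact: mem_head.
by apply: IHe ez => b t u kb et; apply: PS => //; rewrite inE et orbT.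
Qed.

Lemma lspan0 k e : is_subring k -> lspan k e 0.
Proof.
move=> hk; elim: e => //= x e IHe; exists 0, 0; split=> //; first exact: subring0.
by rewrite mul0r addr0.
Qed.

Lemma lspanB k e y z : is_subring k -> lspan k e y -> lspan k e z -> lspan k e (y - z).
Proof.
move=> hk; elim: e y z => [|x e IHe] y z /=; first by move=> -> ->; rewrite subr0.
move=> [a [y' [ka ey' ->]]] [b [z' [kb ez' ->]]]; exists (a - b), (y' - z'); split.
- by case: hk => _ kB _; apply: kB.
- exact: IHe.
- by rewrite mulrBl opprD addrACA.
Qed.

Lemma lspanD k e y z : is_subring k -> lspan k e y -> lspan k e z -> lspan k e (y + z).
Proof.
move=> hk ey ez; rewrite -[z]opprK; apply: lspanB => //.
by rewrite -sub0r; apply: lspanB => //; apply: lspan0.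
Qed.

Lemma lspanZ k e a y : is_subring k -> k a -> lspan k e y -> lspan k e (a * y).
Proof.
move=> hk ka; elim: e y => [|x e IHe] y /=; first by move=> ->; rewrite mulr0.
move=> [b [z [kb ez ->]]]; exists (a * b), (a * z); split; [exact: subringM|exact: IHe|].
by rewrite mulrDr mulrA.
Qed.

Lemma mem_lspan k e x : is_subring k -> x \in e -> lspan k e x.
Proof.
move=> hk; elim: e => //= y e IHe; rewrite inE => /predU1P[->|ex].
  exists 1, 0; split; [by case: hk|exact: lspan0|by rewrite mul1r addr0].
by exists 0, x; split; [exact: subring0|exact: IHe|rewrite mul0r add0r].
Qed.

Lemma sub_lspan k e B y : is_subring B -> (forall a, k a -> B a) ->
  (forall x, x \in e -> B x) -> lspan k e y -> B y.
Proof.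
move=> hB kB eB; apply: lspan_ind; first exact: subring0.
move=> a x z /kB Ba /eB Bx Bz; apply: subringD => //; exact: subringM.
Qed.

Lemma lspan_trans k e e' y : is_subring k ->
  (forall x, x \in e -> lspan k e' x) -> lspan k e y -> lspan k e' y.
Proof.
move=> hk ee'; apply: lspan_ind; first exact: lspan0.
by move=> a x z ka /ee' ex ez; apply: lspanD => //; apply: lspanZ.
Qed.

(** Over a division subring [k] this triangular form amounts to linear independence. *)
Fixpoint lfree k e : Prop :=
  if e is x :: e' then ~ lspan k e' x /\ lfree k e' else True.

Lemma lfree_basis k e : is_subring k -> exists e',
  [/\ {subset e' <= e}, lfree k e' & forall y, lspan k e y -> lspan k e' y].
Proof.
move=> hk; elim: e => [|x e [e' [e'e fe' ee']]]; first by exists [::].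
case: (pselect (lspan k e' x)) => [e'x|Ne'x].
  exists e'; split=> //; first by move=> t /e'e et; rewrite inE et orbT.
  move=> y; apply: lspan_trans => // t; rewrite inE => /predU1P[->//|et].
  by apply: ee'; apply: mem_lspan.
exists (x :: e'); split=> //.
  by move=> t; rewrite !inE => /predU1P[->|/e'e->]; rewrite ?eqxx ?orbT.
by move=> y /= [a [z [ka /ee' ez ->]]]; exists a, z.
Qed.

Lemma lspan_finite k e (s : seq D) : (forall x, k x -> x \in s) ->
  exists t : seq D, forall y, lspan k e y -> y \in t.
Proof.
move=> ks; elim: e => [|x e [t et]]; first by exists [:: 0] => y /= ->; rewrite inE.
exists [seq a * x + z | a <- s, z <- t] => y /= [a [z [ka ez ->]]].
by apply: allpairs_f; [apply: ks|apply: et].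
Qed.

(** Finitely many elements involve only finitely many coefficients, collected in [C]. This serves to
    replace a center by a finitely generated subfield. *)
Lemma lspan_coeffs k e (L : seq D) : (forall y, y \in L -> lspan k e y) ->
  exists C : seq D, (forall c, c \in C -> k c) /\
    forall k' y, (forall c, c \in C -> k' c) -> y \in L -> lspan k' e y.
Proof.
elim: L => [|y L IHL] Le; first by exists [::].
have /IHL [C [kC CL]] : forall z, z \in L -> lspan k e z.
  by move=> z Lz; apply: Le; rewrite inE Lz orbT.
have /Le/lspanP [c [kc ey]] := mem_head y L.
exists (mkseq c (size e) ++ C); split=> [a|k' z].
  by rewrite mem_cat => /orP[/mapP[i]|/kC//]; rewrite mem_iota => /kc kci ->.
move=> Ck'; rewrite inE => /predU1P[->|Lz]; last first.
  by apply: CL => // a Ca; apply: Ck'; rewrite mem_cat Ca orbT.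
apply/lspanP; exists c; split=> // i ie; apply: Ck'; rewrite mem_cat map_f //.
by rewrite mem_iota.
Qed.

(* A polynomial relation with nonzero constant term expresses the inverse of
   [x] as a polynomial in [x]. *)
Lemma subring_lspan_divsubring B k e : is_subring B -> is_divsubring k ->
  (forall a, k a -> B a) -> (forall a x, k a -> B x -> a * x = x * a) ->
  (forall x, B x -> lspan k e x) -> is_divsubring B.
Proof.
move=> hB hk kB kC Be; split; try by case: hB.
move=> x Bx xN0.
have [|kT [f fk]] := field_of_divsubring hD hk.
  by move=> a b ka kb; apply: kC => //; apply: kB.
have kf a : k (f a) by apply/fk; exists a.
have cfx : commr_rmorph f x by move=> a; apply/commr_sym; apply: kC.
pose d := size e.
have /choice [M MP] i : exists c : nat -> kT, x ^+ i = \sum_(j < d) f (c j) * e`_j.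
  have /lspanP [c [kc ->]] := Be _ (subringX i hB Bx).
  have /choice [g gP] j : exists a, (j < d)%N -> f a = c j.
    by case: (ltnP j d) => [/kc/fk [a <-]|_]; [exists a|exists 0].
  by exists g; apply: eq_bigr => j _; rewrite gP.
(* Row [i] holds coordinates of [x ^+ i]. With more rows than columns the left kernel is nonzero,
   and a kernel vector is a polynomial relation for [x]. *)
pose A := \matrix_(i < d.+1, j < d) M i j.
have : kermx A != 0.
  rewrite kermx_eq0 -row_leq_rank -ltnNge ltnS; exact: rank_leq_col.
case/rowV0Pn => v /sub_kermxP vA vN0.
pose p := \poly_(i < d.+1) v 0 (inord i).
have pN0 : p != 0.
  apply: contraNneq vN0 => p0; apply/eqP/rowP => i; rewrite mxE.
  have := coef_poly d.+1 (fun i => v 0 (inord i)) i.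
  by rewrite -/p p0 coef0 ltn_ord inord_val.
have evp : horner_morph cfx p = 0.
  rewrite /p poly_def rmorph_sum /=.
  under eq_bigr => i _ do rewrite -mul_polyC rmorphM rmorphXn /= horner_morphC horner_morphX inord_val MP mulr_sumr.
  rewrite exchange_big big1 //= => j _.
  under eq_bigr => i _ do rewrite mulrA -rmorphM.
  rewrite -mulr_suml -rmorph_sum /=.
  move/rowP/(_ j): vA; rewrite !mxE => vAj.
  by rewrite (eq_bigr (fun i => v 0 i * A i j)) ?vAj ?rmorph0 ?mul0r // => i _; rewrite mxE.
(* Splitting off the largest power of ['X] makes the constant term of [q] nonzero; since [x != 0],
   [q] still vanishes at [x]. *)
have [m [q /implyP/(_ pN0)]] := multiplicity_XsubC p 0.
rewrite subr0 rootE => q0 pq.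
have evq : horner_morph cfx q = 0.
  move: evp; rewrite pq rmorphM rmorphXn /= horner_morphX => /divring_mul_eq0[] // /eqP.
  by rewrite (negPf (divring_expr_neq0 _ xN0)).
have /factor_theorem [r rq] : root (q - (q.[0])%:P) 0.
  by rewrite rootE !hornerE subrr.
pose u := horner_morph cfx r.
have ux : u * x = - f q.[0].
  move/(congr1 (horner_morph cfx)): rq.
  by rewrite subr0 rmorphM rmorphB /= evq horner_morphC horner_morphX sub0r => <-.
have xN : x^-1 = - f (q.[0])^-1 * u.
  apply: (mulIr (hD xN0)); rewrite mulVr ?hD // -mulrA ux mulrNN -rmorphM.
  by rewrite mulVf // rmorph1.
rewrite xN; apply: subringM => //; first by apply: subringN => //; apply: kB.
rewrite /u /horner_morph horner_poly; apply: subring_sum => // i _.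
by apply: subringM => //; [apply: kB|apply: subringX].
Qed.

End Subrings.

(** * Orders with a central uniformizer and their finite extensions *)

Section AdicOrders.
Variables (D : unitRingType) (hD : is_division_ring D).
Implicit Types (A B E R k : D -> Prop) (x y z pi : D) (e S C : seq D).

(** A substitute for a valuation ring: [adic_absorb] says that [E = R[1/pi]], and [adic_sep] that
    the [pi]-adic topology is separated. [adic_prime] bounds the valuation of [l] by that of
    [pi ^+ (l - 2)], which is what the last term of a binomial expansion of exponent [l] needs; at
    [l = 2] it makes 2 invertible in [R]. *)
Record adic_order E R pi : Prop := AdicOrder {
  adic_subring : is_subring R;
  adic_sub : forall x, R x -> E x;
  adic_mem : R pi;
  adic_neq0 : pi != 0;
  adic_comm : forall y, E y -> pi * y = y * pi;
  adic_absorb : forall y, E y -> exists m, R (pi ^+ m * y);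
  adic_sep : forall y, (forall j, exists r, R r /\ y = pi ^+ j * r) -> y = 0;
  adic_prime : forall l, prime l -> l%:R != 0 :> D ->
    exists r, R r /\ pi ^+ (l - 2) = l%:R * r
}.

Lemma adic_absorbW E R pi y m n : adic_order E R pi -> (m <= n)%N ->
  R (pi ^+ m * y) -> R (pi ^+ n * y).
Proof.
move=> oR /subnK <- Ry; rewrite exprD -mulrA.
have hR := adic_subring oR; apply: subringM => //.
by apply: subringX => //; apply: adic_mem oR.
Qed.

(** Coordinates on a free list are unique, so divisibility of [y] by every [pi ^+ j] passes to each
    coordinate, which vanishes by separation of [A]. *)
Lemma lspan_sep k A pi e y : is_divsubring k -> (forall a, A a -> k a) -> k pi ->
  (forall a, (forall j, exists r, A r /\ a = pi ^+ j * r) -> a = 0) -> lfree k e ->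
  (forall j, exists r, lspan A e r /\ y = pi ^+ j * r) -> y = 0.
Proof.
move=> hk Ak kpi Asep; have hk' := divsubring_subring hk.
elim: e y => [|x e IHe] y /=; first by move=> _ /(_ 0%N) [r [-> ->]]; rewrite mulr0.
move=> [Nex fe] yj.
have lAk z : lspan A e z -> lspan k e z.
  move/lspanP => [c [Ac ->]]; apply/lspanP; exists c; split=> // i ie.
  by apply: Ak; apply: Ac.
have coord a b z t : k a -> k b -> lspan k e z -> lspan k e t ->
    a * x + z = b * x + t -> a = b.
  move=> ka kb ez et eqab; apply/eqP; rewrite -subr_eq0; apply/negP => /negP abN0.
  apply: Nex; have kab : k (a - b) by case: (hk') => _ kB _; apply: kB.
  have -> : x = (a - b)^-1 * (t - z).
    apply: (mulrI (hD abN0)); rewrite mulrA mulrV ?hD // mul1r mulrBl.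
    by apply/eqP; rewrite subr_eq addrAC eq_sym subr_eq addrC eqab addrC.
  by apply: lspanZ => //; [apply: divsubring_inv|apply: lspanB].
have [_ [[a [z [Aa ez ->]] y0]]] := yj 0%N; rewrite expr0 mul1r in y0.
have aj j : exists b t, [/\ A b, lspan A e t, a = pi ^+ j * b & y = pi ^+ j * b * x + pi ^+ j * t].
  have [_ [[b [t [Ab et ->]] yE]]] := yj j; exists b, t; split=> //; last by rewrite yE mulrDr mulrA.
  have kpj : k (pi ^+ j) by apply: subringX.
  apply: (@coord _ _ z (pi ^+ j * t)).
  - exact: Ak.
  - by apply: subringM => //; apply: Ak.
  - exact: lAk.
  - by apply: lspanZ => //; apply: lAk.
  - by rewrite -y0 yE mulrDr mulrA.
have a0 : a = 0 by apply: Asep => j; have [b [t [Ab _ -> _]]] := aj j; exists b.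
apply: (IHe _ fe) => j; have [b [t [Ab et ab ->]]] := aj j; exists t; split=> //.
by rewrite -ab a0 mul0r add0r.
Qed.

(* The order is the left multiplier ring of the lattice spanned by a basis. *)
Lemma adic_order_ext k A pi E e :
  is_divsubring k -> is_divsubring E -> (forall a, k a -> E a) ->
  (forall a x, k a -> E x -> a * x = x * a) ->
  (forall x, x \in e -> E x) -> (forall x, E x -> lspan k e x) ->
  adic_order k A pi -> exists R, adic_order E R pi.
Proof.
move=> hk hE kE kC eE0 Ee0 oA.
have hk' := divsubring_subring hk; have hE' := divsubring_subring hE.
have [e' [e'e fe Ee']] := lfree_basis e hk'.
have eE x : x \in e' -> E x by move/e'e/eE0.
have Ee x : E x -> lspan k e' x by move/Ee0/Ee'.
move: e' fe eE Ee {e e'e eE0 Ee0 Ee'} => e fe eE Ee.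
have hA := adic_subring oA; have Ak := adic_sub oA; have Api := adic_mem oA.
have kpi := Ak _ Api.
have Api_n n : A (pi ^+ n) by apply: subringX.
have lE y : lspan A e y -> E y.
  by apply: sub_lspan => // a /Ak/kE.
have absorb y : lspan k e y -> exists m, lspan A e (pi ^+ m * y).
  elim: {+}e y => [|x e1 IHe] y /=; first by move=> ->; exists 0%N; rewrite mulr0.
  move=> [a [z [ka /IHe [m mz] ->]]]; have [n na] := adic_absorb oA ka.
  exists (m + n)%N, (pi ^+ (m + n) * a), (pi ^+ (m + n) * z); split.
  - exact: adic_absorbW oA (leq_addl _ _) na.
  - by rewrite addnC exprD -mulrA; apply: lspanZ.
  - by rewrite mulrDr mulrA.
pose R x := E x /\ forall z, lspan A e z -> lspan A e (x * z).
have AR a : A a -> R a by move=> Aa; split=> [|z ez]; [apply/kE/Ak|apply: lspanZ].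
exists R; split=> //.
- split; first by apply: AR; case: hA.
  + move=> x y [Ex Rx] [Ey Ry]; split; first by case: hE' => _ EB _; apply: EB.
    by move=> z ez; rewrite mulrBl; apply: lspanB => //; [apply: Rx|apply: Ry].
  + move=> x y [Ex Rx] [Ey Ry]; split; first exact: subringM.
    by move=> z ez; rewrite -mulrA; apply/Rx/Ry.
- by move=> x [].
- exact: AR.
- exact: adic_neq0 oA.
- by move=> y; apply: kC.
- move=> y Ey.
  (* It suffices to bring the finitely many products of [y] with the vectors of [e] into the
     lattice; the sum of their exponents works for all. *)
  have [m mP] : exists m, forall z, lspan A e z -> lspan A e (pi ^+ m * y * z).
    elim: {1 2}e eE => [|x e1 IHe] /= e1E.
      by exists 0%N => z ->; rewrite mulr0; apply: lspan0.
    have /IHe [m mP] : forall t, t \in e1 -> E t.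
      by move=> t e1t; apply: e1E; rewrite inE e1t orbT.
    have [n nP] : exists n, lspan A e (pi ^+ n * (y * x)).
      by apply/absorb/Ee; apply: subringM => //; apply: e1E; rewrite mem_head.
    exists (m + n)%N => _ [a [z [Aa /mP ez ->]]]; rewrite mulrDr; apply: lspanD => //.
      have ka := Ak _ Aa; have Epn := kE _ (Ak _ (Api_n (m + n)%N)).
      rewrite mulrA -(mulrA _ y) -(kC a y) // mulrA -(kC a) // exprD -!mulrA.
      by do 2![apply: lspanZ => //].
    by rewrite addnC exprD -!mulrA; apply: lspanZ => //; rewrite mulrA.
  exists m; split=> //; apply: subringM => //; exact/kE/Ak/Api_n.
- move=> y yj.
  (* Test [y] on the multiple [pi ^+ m] of 1 in the lattice: the product lies in [pi ^+ j] times the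
     lattice for every [j]. *)
  have [m em] : exists m, lspan A e (pi ^+ m * 1) by apply/absorb/Ee; case: hE.
  rewrite mulr1 in em.
  have ym : y * pi ^+ m = 0.
    apply: (lspan_sep hk Ak kpi (adic_sep oA) fe) => j.
    by have [r [[Er Rr] ->]] := yj j; exists (r * pi ^+ m); rewrite mulrA; split=> //; apply: Rr.
  have /divring_mul_eq0 := ym; case=> // /eqP.
  by rewrite (negPf (divring_expr_neq0 hD _ (adic_neq0 oA))).
- by move=> l l_pr lN0; have [r [/AR Rr ->]] := adic_prime oA l_pr lN0; exists r.
Qed.

End AdicOrders.

(** * The prime field: finite, or Q with a 3-adic order *)

Section PrimeField.
Variables (D : unitRingType) (hD : is_division_ring D).
Implicit Types (A B E R k : D -> Prop) (x y z pi : D) (e S C : seq D).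

Definition finite_or_adic E : Prop :=
  (exists s : seq D, forall x, E x -> x \in s) \/ (exists R pi, adic_order E R pi).

Lemma prime_field_finite p : prime p -> p%:R = 0 :> D ->
  exists s : seq D, forall x, divsubring_gen [::] x -> x \in s.
Proof.
move=> p_pr p0; pose A x := exists n, x = n%:R.
have pchar : p \in [pchar D] by rewrite inE p_pr p0 eqxx.
have hA : is_divsubring A.
  split=> [|x y [m ->] [n ->]|x y [m ->] [n ->]|x [m ->] mN0].
  - by exists 1%N.
  (* [n * p.-1] represents [- n] modulo [p]. *)
  - exists (m + n * p.-1)%N; rewrite natrD; congr (_ + _).
    by apply/eqP; rewrite eq_sym -subr_eq0 opprK -natrD -mulnSr prednK ?prime_gt0 // natrM p0 mulr0.
  - by exists (m * n)%N; rewrite natrM.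
  (* The inverse given by Fermat's little theorem. *)
  - exists (m ^ (p - 2))%N; apply: (mulrI (hD mN0)); rewrite mulrV ?hD //.
    apply: (mulrI (hD mN0)); rewrite mulr1 natrX -!exprS.
    rewrite (_ : (p - 2).+2 = p); last by have := prime_gt1 p_pr; lia.
    by rewrite -(pFrobenius_autE pchar) pFrobenius_aut_nat.
exists [seq i%:R | i <- iota 0 p] => x /(sub_divsubring_gen hA) [] // n ->.
apply/mapP; exists (n %% p)%N; first by rewrite mem_iota ltn_mod prime_gt0.
by rewrite {1}(divn_eq n p) natrD natrM p0 mulr0 add0r.
Qed.

(** [R] is the localization of Z at 3. The 2-adic order would violate [adic_prime] at [l = 2]; here
    2 is invertible, and at [l = 3] the exponent [l - 2 = 1] is just enough. *)
Lemma prime_field_adic : (forall p, prime p -> p%:R != 0 :> D) ->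
  exists R, adic_order (divsubring_gen [::]) R (3%:R : D).
Proof.
move=> char0.
have natN0 n : (0 < n)%N -> n%:R != 0 :> D.
  elim/ltn_ind: n => n IHn n0; case: (ltnP 1 n) => [n1|]; last by case: n n0 {IHn} => [|[]] // _ _; apply: oner_neq0.
  have /dvdnP [m mE] := pdiv_dvd n; have pr := pdiv_prime n1.
  have m0 : (0 < m)%N by case: m mE => // n0'; rewrite n0' in n0.
  have mn : (m < n)%N by rewrite mE -{1}(muln1 m) ltn_pmul2l ?prime_gt1.
  by rewrite mE natrM; apply/eqP => /(divring_mul_eq0 hD) [] /eqP; apply/negP; [apply: IHn|apply: char0].
have intN0 (m : int) : m%:~R = 0 :> D -> m = 0.
  case: m => [[|n]|n] //; first by move/eqP; rewrite (negPf (natN0 n.+1 _)).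
  by rewrite NegzE rmorphN => /eqP; rewrite oppr_eq0 (negPf (natN0 n.+1 _)).
have natC n x : n%:R * x = x * n%:R by rewrite mulr_natl mulr_natr.
pose E := @divsubring_gen D [::].
have hE : is_divsubring E := divsubring_gen_divsubring _.
have hE' := divsubring_subring hE.
have intE (m : int) : E m%:~R.
  case: m => n; first exact: (subring_nat n hE').
  by rewrite NegzE rmorphN; exact: (subringN hE' (subring_nat n.+1 hE')).
have fracB (x1 x2 : D) (m1 m2 : int) n1 n2 : x1 * n1%:R = m1%:~R -> x2 * n2%:R = m2%:~R ->
    (x1 - x2) * (n1 * n2)%N%:R = (m1 * n2%:Z - m2 * n1%:Z)%:~R.
  move=> e1 e2; rewrite natrM rmorphB !rmorphM /= -e1 -e2 mulrBl !mulrA.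
  by congr (_ - _); rewrite -!mulrA (natC n1).
have fracM (x1 x2 : D) (m1 m2 : int) n1 n2 : x1 * n1%:R = m1%:~R -> x2 * n2%:R = m2%:~R ->
    (x1 * x2) * (n1 * n2)%N%:R = (m1 * m2)%:~R.
  by move=> e1 e2; rewrite natrM rmorphM /= -e1 -e2 -!mulrA (mulrA n1%:R x2) (natC n1 x2) !mulrA.
pose Q x := exists (m : int) (n : nat), (0 < n)%N /\ x * n%:R = m%:~R.
have EQ x : E x -> Q x.
  apply: sub_divsubring_gen => //; split=> [|x1 x2 [m1 [n1 [n1P e1]]] [m2 [n2 [n2P e2]]]|x1 x2 [m1 [n1 [n1P e1]]] [m2 [n2 [n2P e2]]]|x1 [m [n [nP e1]]] x1N0].
  - by exists 1, 1%N; rewrite mul1r.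
  - exists (m1 * n2%:Z - m2 * n1%:Z), (n1 * n2)%N; rewrite muln_gt0 n1P n2P; split=> //.
    exact: fracB.
  - exists (m1 * m2), (n1 * n2)%N; rewrite muln_gt0 n1P n2P; split=> //.
    exact: fracM.
  - have mE : x1^-1 * m%:~R = n%:R by rewrite -e1 mulrA mulVr ?hD ?mul1r.
    have mN0 : m <> 0.
      by move=> m0; move: (natN0 n nP); rewrite -mE m0 mulr0 eqxx.
    case: m {e1} mE mN0 => [[|m]|m] // mE _; first by exists n, m.+1.
    by exists (- n%:Z), m.+1; split=> //; rewrite rmorphN /= -[n%:~R]/(n%:R) -mE NegzE rmorphN mulrN opprK.
pose R x := exists (m : int) (n : nat), ~~ (3 %| n)%N /\ x * n%:R = m%:~R.
have dvd3_gt0 n : ~~ (3 %| n)%N -> (0 < n)%N by case: n.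
have RQ (x : D) : R x -> Q x by move=> [m [n [/dvd3_gt0 n3 e]]]; exists m, n.
exists R; split.
- split=> [|x1 x2 [m1 [n1 [n1P e1]]] [m2 [n2 [n2P e2]]]|x1 x2 [m1 [n1 [n1P e1]]] [m2 [n2 [n2P e2]]]].
  + by exists 1, 1%N; rewrite mul1r.
  + exists (m1 * n2%:Z - m2 * n1%:Z), (n1 * n2)%N; rewrite Euclid_dvdM // negb_or n1P n2P; split=> //.
    exact: fracB.
  + exists (m1 * m2), (n1 * n2)%N; rewrite Euclid_dvdM // negb_or n1P n2P; split=> //.
    exact: fracM.
- move=> x /RQ [m [n [/natN0 nP e1]]].
  rewrite -(mulrK (hD nP) x) e1.
  exact: (subringM hE' (intE m) (divsubring_inv hE (subring_nat n hE'))).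
- by exists 3, 1%N; rewrite mulr1.
- exact: natN0.
- by move=> y _; apply: natC.
(* Multiplying by the 3-part of the denominator leaves the denominator [n'], prime to 3. *)
- move=> y /EQ [m [n [nP e1]]]; have [n' n'P nE] := pfactor_coprime (isT : prime 3) nP.
  exists (logn 3 n), m, n'; split; first by rewrite -prime_coprime.
  by rewrite -e1 -mulrA -natrX natC -mulrA -natrM -nE.
- move=> y yj; have [x0 [[m [n [nP e1]]]]] := yj 0%N; rewrite expr0 mul1r => yx0.
  rewrite -{}yx0 in e1.
  suff m0 : m = 0.
    have /(divring_mul_eq0 hD) [] // : y * n%:R = 0 by rewrite e1 m0.
    by move/eqP; rewrite (negPf (natN0 _ (dvd3_gt0 _ nP))).
  (* Every power of 3 divides the numerator, which is therefore zero by size. *)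
  have dj j : (3 ^ j %| `|m|)%N.
    have [r [[m' [n' [n'P e2]]] yr]] := yj j.
    have : m * n'%:Z - (3 ^ j)%N%:Z * m' * n%:Z = 0.
      apply: intN0; rewrite rmorphB !rmorphM /= -e1 -e2 yr -natrX.
      by apply/eqP; rewrite subr_eq0 -!mulrA (natC n').
    move/eqP; rewrite subr_eq0 => /eqP/(congr1 absz); rewrite !abszM /= => eqm.
    have c3 : coprime (3 ^ j) n' by apply: coprimeXl; rewrite prime_coprime.
    by rewrite -(Gauss_dvdl _ c3) eqm -mulnA dvdn_mulr.
  apply/eqP; rewrite -absz_eq0; apply/negPn; rewrite -lt0n; apply/negP => /dvdn_leq/(_ (dj `|m|%N)).
  by rewrite leqNgt ltn_expl.
- move=> l l_pr lN0; case: (eqVneq l 3%N) => [->|lN3].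
    by exists 1; rewrite mulr1; split=> //; exists 1, 1%N; rewrite mul1r.
  exists (l%:R^-1 * 3%:R ^+ (l - 2)); rewrite mulrA mulrV ?hD ?mul1r //; split=> //.
  exists (3 ^ (l - 2))%N%:Z, l; rewrite dvdn_prime2 // eq_sym lN3; split=> //.
  by rewrite -mulrA -natC mulrA mulVr ?hD ?mul1r // -natrX.
Qed.

Lemma prime_field_finite_or_adic : finite_or_adic (divsubring_gen [::]).
Proof.
case: (pselect (exists p, prime p /\ p%:R = 0 :> D)) => [[p [p_pr p0]]|N].
  by left; apply: prime_field_finite p0.
right; have [|R oR] := prime_field_adic; last by exists R, 3%:R.
by move=> p p_pr; apply/eqP => p0; apply: N; exists p.
Qed.

End PrimeField.

(** * From the prime field to division rings finite dimensional over their center *)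

Section FinitelyGenerated.
Variables (D : unitRingType) (hD : is_division_ring D).
Implicit Types (A B E R k : D -> Prop) (x y z pi : D) (e S C : seq D).

Lemma finite_or_adic_ext k E e :
  is_divsubring k -> is_divsubring E -> (forall a, k a -> E a) ->
  (forall a x, k a -> E x -> a * x = x * a) ->
  (forall x, x \in e -> E x) -> (forall x, E x -> lspan k e x) ->
  finite_or_adic k -> finite_or_adic E.
Proof.
move=> hk hE kE kC eE Ee [[s ks]|[A [pi oA]]]; [left|right].
  by have [t et] := lspan_finite e ks; exists t => x /Ee/et.
by have [R oR] := adic_order_ext hD hk hE kE kC eE Ee oA; exists R, pi.
Qed.

(** * Adjoining one commuting element [c] to a field *)

Section Adjunction.
Variables (kT : fieldType) (f : {rmorphism kT -> D}) (c : D).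
Hypothesis cfc : commr_rmorph f c.
Let ev : {rmorphism {poly kT} -> D} := horner_morph cfc.
Variable E : D -> Prop.
Hypotheses (hE : is_divsubring E) (fE : forall a, E (f a)) (Ec : E c).
Hypothesis Emin : forall B, is_divsubring B -> (forall a, B (f a)) -> B c ->
  forall x, E x -> B x.

Let ev_polyC a : ev a%:P = f a.
Proof. exact: horner_morphC. Qed.

Let ev_polyX : ev 'X = c.
Proof. exact: horner_morphX. Qed.

Let evE p : ev p = (map_poly f p).[c].
Proof. by []. Qed.

Let evC (p q : {poly kT}) : ev p * ev q = ev q * ev p.
Proof. by rewrite -!rmorphM mulrC. Qed.

Let Eev p : E (ev p).
Proof.
rewrite evE horner_poly; apply: subring_sum => [|i _].
  exact: divsubring_subring.
have hE' := divsubring_subring hE; apply: subringM => //; exact: subringX.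
Qed.

(** Reduction modulo [p] shows that the polynomials in [c] are spanned by finitely many powers. They
    thus form a division subring by [subring_lspan_divsubring], hence exhaust [E]. *)
Lemma algebraic_lspan (p : {poly kT}) : p != 0 -> ev p = 0 ->
  forall x, E x -> lspan (fun a => exists b, f b = a) (mkseq (GRing.exp c) (size p)) x.
Proof.
move=> pN0 evp; pose k a := exists b, f b = a; pose B x := exists q, ev q = x.
have hk : is_divsubring k.
  split=> [|_ _ [a <-] [b <-]|_ _ [a <-] [b <-]|_ [a <-] aN0].
  - by exists 1; rewrite rmorph1.
  - by exists (a - b); rewrite rmorphB.
  - by exists (a * b); rewrite rmorphM.
  - exists a^-1; apply: (mulrI (hD aN0)); rewrite mulrV ?hD // -rmorphM mulfV ?rmorph1 //.
    by apply: contraNneq aN0 => ->; rewrite rmorph0.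
have kB a : k a -> B a by move=> [b <-]; exists b%:P; rewrite ev_polyC.
have hB : is_subring B.
  split=> [|_ _ [a <-] [b <-]|_ _ [a <-] [b <-]].
  - by exists 1; rewrite rmorph1.
  - by exists (a - b); rewrite rmorphB.
  - by exists (a * b); rewrite rmorphM.
have Be x : B x -> lspan k (mkseq (GRing.exp c) (size p)) x.
  move=> [q <-]; apply/lspanP; exists (fun i => f (q %% p)`_i); split=> [i _|].
    by exists (q %% p)`_i.
  rewrite size_mkseq {1}(divp_eq q p) rmorphD rmorphM /= evp mulr0 add0r.
  have qp : (size (q %% p)%R <= size p)%N by rewrite ltnW ?ltn_modp.
  rewrite evE (horner_coef_wide _ (leq_trans (size_poly _ _) qp)).
  by apply: eq_bigr => i _; rewrite coef_map nth_mkseq.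
move=> x Ex; apply: (Be); apply: Emin Ex.
- apply: (subring_lspan_divsubring hD hB hk kB _ Be) => _ _ [a <-] [q <-].
  by rewrite -ev_polyC evC.
- by move=> a; apply: kB; exists a.
- by exists 'X; rewrite ev_polyX.
Qed.

(** [E] is a rational function field in [c], and [R] is its local ring at [c = 0], with uniformizer
    [c]. *)
Lemma transcendental_adic : (forall p, ev p = 0 -> p = 0) -> exists R, adic_order E R c.
Proof.
move=> tr; have hE' := divsubring_subring hE.
have evN0 p : p != 0 -> ev p != 0 by apply: contraNneq => /tr ->.
have evI p q : ev p = ev q -> p = q.
  by move=> epq; apply/eqP; rewrite -subr_eq0; apply/eqP/tr; rewrite rmorphB epq subrr.
pose frac x := exists p q, q != 0 /\ x * ev q = ev p.
have fracB x1 x2 p1 q1 p2 q2 : x1 * ev q1 = ev p1 -> x2 * ev q2 = ev p2 ->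
    (x1 - x2) * ev (q1 * q2) = ev (p1 * q2 - p2 * q1).
  move=> e1 e2; rewrite rmorphB !rmorphM /= -e1 -e2 mulrBl !mulrA.
  by congr (_ - _); rewrite -!mulrA evC.
have fracM x1 x2 p1 q1 p2 q2 : x1 * ev q1 = ev p1 -> x2 * ev q2 = ev p2 ->
    (x1 * x2) * ev (q2 * q1) = ev (p1 * p2).
  move=> e1 e2; rewrite !rmorphM /= -mulrA (mulrA x2) e2 -e1 -mulrA; congr (_ * _).
  exact: evC.
have Efrac x : E x -> frac x.
  move=> Ex; apply: Emin Ex.
  - split=> [|x1 x2 [p1 [q1 [q1P e1]]] [p2 [q2 [q2P e2]]]|x1 x2 [p1 [q1 [q1P e1]]] [p2 [q2 [q2P e2]]]|x1 [p [q [qP e]]] xN0].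
    + by exists 1, 1; rewrite oner_neq0 mul1r.
    + by exists (p1 * q2 - p2 * q1), (q1 * q2); rewrite mulf_neq0 //; split=> //; apply: fracB.
    + by exists (p1 * p2), (q2 * q1); rewrite mulf_neq0 //; split=> //; apply: fracM.
    + exists q, p; split; last by rewrite -e mulrA mulVr ?hD ?mul1r.
      apply/eqP => p0; move: e; rewrite p0 rmorph0 => /(divring_mul_eq0 hD) [] /eqP; apply/negP => //.
      exact: evN0.
  - by move=> a; exists a%:P, 1; rewrite oner_neq0 rmorph1 mulr1 ev_polyC.
  - by exists 'X, 1; rewrite oner_neq0 rmorph1 mulr1 ev_polyX.
have cE n : c ^+ n = ev 'X^n by rewrite rmorphXn /= ev_polyX.
have n0_neq0 (q : {poly kT}) : q.[0] != 0 -> q != 0.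
  by apply: contraNneq => ->; rewrite horner0.
have cN0 : c != 0 by rewrite -[c]expr1 cE evN0 // -size_poly_eq0 size_polyXn.
have cC y : E y -> c * y = y * c.
  move=> /Efrac [p [q [qP e]]]; apply: (mulIr (hD (evN0 _ qP))).
  by rewrite -!mulrA e -(ev_polyX) evC -e -mulrA (evC 'X).
pose R x := exists p q, q.[0] != 0 /\ x * ev q = ev p.
exists R; split=> //.
- split=> [|x1 x2 [p1 [q1 [q1P e1]]] [p2 [q2 [q2P e2]]]|x1 x2 [p1 [q1 [q1P e1]]] [p2 [q2 [q2P e2]]]].
  + by exists 1, 1; rewrite hornerC oner_neq0 mul1r.
  + by exists (p1 * q2 - p2 * q1), (q1 * q2); rewrite hornerM mulf_neq0 //; split=> //; apply: fracB.
  + by exists (p1 * p2), (q2 * q1); rewrite hornerM mulf_neq0 //; split=> //; apply: fracM.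
- move=> x [p [q [/n0_neq0/evN0 qP e]]]; rewrite -(mulrK (hD qP) x) e.
  by apply: subringM => //; apply: divsubring_inv.
- by exists 'X, 1; rewrite hornerC oner_neq0 rmorph1 mulr1 ev_polyX.
- move=> y Ey; have [p [q [qP e]]] := Efrac y Ey.
  (* The power of ['X] in the denominator is the exponent that brings [y] into [R]. *)
  have [m [q' /implyP/(_ qP)]] := multiplicity_XsubC q 0.
  rewrite subr0 rootE => q'0 qE; exists m, p, q'; split=> //.
  rewrite -e qE mulrC rmorphM /= -cE mulrA; congr (_ * _).
  by apply/esym/commrX/esym/cC.
- move=> y yj; have [x0 [[p [q [qP e]]]]] := yj 0%N; rewrite expr0 mul1r => yx0.
  rewrite -{}yx0 in e.
  suff p0 : p = 0.
    move: e; rewrite p0 rmorph0 => /(divring_mul_eq0 hD) [] // /eqP.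
    by rewrite (negPf (evN0 _ (n0_neq0 _ qP))).
  apply/eqP/negPn/negP => pN0.
  (* The exponent exceeds the degree of [p]: ['X^(size p)] divides [p * q'] and is coprime to [q'],
     so it would divide [p]. *)
  have [r [[p' [q' [q'P e']]] yr]] := yj (size p).
  have eqp : p * q' = 'X^(size p) * p' * q.
    by apply: evI; rewrite !rmorphM /= -cE -e -e' yr -!mulrA evC.
  have : 'X^(size p) %| p * q' by rewrite eqp -mulrA dvdp_mulr.
  rewrite Gauss_dvdpl; last first.
    by rewrite coprimep_expl // coprimep_sym coprimepX // rootE.
  by move/(dvdp_leq pN0); rewrite size_polyXn ltnn.
- move=> l l_pr lN0.
  have lkN0 : l%:R != 0 :> kT by apply: contraNneq lN0 => l0; rewrite -(rmorph_nat f) l0 rmorph0.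
  exists (ev ((l%:R^-1)%:P * 'X^(l - 2))); split.
    by exists ((l%:R^-1)%:P * 'X^(l - 2)), 1; rewrite hornerC oner_neq0 rmorph1 mulr1.
  by rewrite cE -[l%:R](rmorph_nat ev) -rmorphM mulrA -polyC_natr -polyCM mulfV // mul1r.
Qed.

End Adjunction.

(** Generators are adjoined one at a time. An algebraic one is a finite extension, which transports
    either alternative; a transcendental one provides a fresh [c]-adic order, whatever was known of
    [k]. *)
Lemma finite_or_adic_gen C : (forall x y, x \in C -> y \in C -> x * y = y * x) ->
  finite_or_adic (divsubring_gen C).
Proof.
elim: C => [|c C IHC] comC; first exact: prime_field_finite_or_adic.
pose k := divsubring_gen C; pose E := divsubring_gen (c :: C).
have foak : finite_or_adic k.
  by apply: IHC => x y Cx Cy; apply: comC; rewrite inE ?Cx ?Cy orbT.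
have hk : is_divsubring k := divsubring_gen_divsubring _.
have hE : is_divsubring E := divsubring_gen_divsubring _.
have kE a : k a -> E a.
  by apply: sub_divsubring_gen => // x Cx; apply: mem_divsubring_gen; rewrite inE Cx orbT.
have EC x y : E x -> E y -> x * y = y * x.
  move=> Ex; apply: comm_divsubring_gen => s Cs; apply/esym.
  by apply: comm_divsubring_gen Ex => t Ct; apply: comC.
have [|kT [f fk]] := field_of_divsubring hD hk.
  by move=> x y /kE Ex /kE; apply: EC.
have kf a : k (f a) by apply/fk; exists a.
have Ec : E c by apply: mem_divsubring_gen; rewrite mem_head.
have cfc : commr_rmorph f c by move=> a; apply: EC => //; apply: kE.
have fE a : E (f a) by apply: kE.
have Emin B : is_divsubring B -> (forall a, B (f a)) -> B c -> forall x, E x -> B x.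
  move=> hB fB Bc; apply: sub_divsubring_gen => // x; rewrite inE => /predU1P[->//|Cx].
  by have /fk [a <-] : k x by apply: mem_divsubring_gen.
case: (pselect (exists p : {poly kT}, p != 0 /\ horner_morph cfc p = 0)) => [[p [pN0 pc]]|tr].
  apply: (@finite_or_adic_ext k _ (mkseq (GRing.exp c) (size p))) foak => //.
  - by move=> a x /kE; apply: EC.
  - by move=> _ /mapP [i _ ->]; apply: (subringX _ (divsubring_subring hE)).
  - move=> x Ex; have /lspanP [g [gk ->]] := algebraic_lspan Emin pN0 pc Ex.
    by apply/lspanP; exists g; split=> // i /gk/fk.
right; have [|R oR] := transcendental_adic hE fE Ec Emin (cfc := cfc); last by exists R, c.
by move=> p pc; apply/eqP/negPn/negP => pN0; apply: tr; exists p.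
Qed.

(** Finitely many central coefficients already generate a field [k] over which [e] spans a division
    subring containing [S], hence all of [E]. *)
Lemma finite_or_adic_fin_dim S : fin_dim_over_center (divsubring_gen S) ->
  finite_or_adic (divsubring_gen S).
Proof.
move=> [e [eE Ee]]; set E := divsubring_gen S in eE Ee *.
have hE : is_divsubring E := divsubring_gen_divsubring _.
have hZ := center_divsubring hE; have hE' := divsubring_subring hE.
(* Coordinates of the products make the [k]-span of [e] closed under multiplication; those of 1 and
   of [S] put these elements into it. *)
pose L := 1 :: S ++ [seq x * y | x <- e, y <- e].
have LE y : y \in L -> E y.
  rewrite inE mem_cat => /or3P[/eqP->|/mem_divsubring_gen//|/allpairsP[[a b] [/= ea eb ->]]].
    by case: hE.
  by apply: (subringM hE'); apply: eE.
have [|C [CZ CL]] := @lspan_coeffs D (center_of E) e L.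
  move=> y /LE/Ee [c [sc [cZ ->]]]; apply/lspanP; exists (nth 0 c); split=> // i ie.
  by apply: cZ; rewrite mem_nth // sc.
pose k := divsubring_gen C.
have hk : is_divsubring k := divsubring_gen_divsubring _.
have hk' := divsubring_subring hk.
have kZ a : k a -> center_of E a by apply: sub_divsubring_gen.
have kL y : y \in L -> lspan k e y by apply: CL => c; apply: mem_divsubring_gen.
have kE a : k a -> E a by case/kZ.
have lE y : lspan k e y -> E y by apply: sub_lspan.
have hB : is_subring (lspan k e).
  split; first by apply: kL; rewrite mem_head.
    by move=> x y; apply: lspanB.
  have mulE x y : x \in e -> lspan k e y -> lspan k e (x * y).
    move=> ex; apply: (lspan_ind (P := fun y => lspan k e (x * y))).
      by rewrite mulr0; apply: lspan0.
    move=> a z t ka ez xt; rewrite mulrDr; apply: lspanD => //.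
    have [_ aC] := kZ _ ka; rewrite mulrA -aC -?mulrA; last exact: eE.
    by apply: lspanZ => //; apply: kL; rewrite inE mem_cat allpairs_f ?orbT.
  move=> x y ex ey; move: x ex; apply: (lspan_ind (P := fun x => lspan k e (x * y))).
    by rewrite mul0r; apply: lspan0.
  move=> a z t ka ez ty; rewrite mulrDl; apply: lspanD => //.
  by rewrite -mulrA; apply: lspanZ => //; apply: mulE.
have hB' : is_divsubring (lspan k e).
  apply: (subring_lspan_divsubring (e := e) hD hB hk) => // [a ka|a x /kZ [_ aC] /lE]; last exact: aC.
  by rewrite -[a]mulr1; apply: lspanZ => //; case: hB.
have Ek x : E x -> lspan k e x.
  apply: sub_divsubring_gen => // s Ss; apply: kL.
  by rewrite inE mem_cat Ss orbT.
apply: (@finite_or_adic_ext k _ e) => //.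
  by move=> a x /kZ [_]; apply.
apply: finite_or_adic_gen => x y /CZ [_ xC] /CZ [Ey _]; exact: xC.
Qed.

End FinitelyGenerated.

(** * Uniqueness of roots in [1 + pi R] *)

Section Roots.
Variables (D : unitRingType) (hD : is_division_ring D).

(** Powers of the characteristic exponent: only 1 in characteristic zero, the powers of [p] in
    characteristic [p]. *)
Definition char_number (q : nat) : Prop :=
  (0 < q)%N /\ forall l, prime l -> (l %| q)%N -> l%:R = 0 :> D.

Lemma char_number_ind (P : nat -> Prop) : P 1%N ->
  (forall m l, prime l -> l%:R = 0 :> D -> P m -> P (m * l)%N) ->
  forall q, char_number q -> P q.
Proof.
move=> P1 PM; elim/ltn_ind => q IHq [q0 qD].
case: (ltnP 1 q) => [q1|]; last by case: q q0 {IHq qD} => [|[|]].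
have pr := pdiv_prime q1; have /dvdnP [m qE] := pdiv_dvd q.
have m0 : (0 < m)%N by case: m qE => // qE; rewrite qE in q0.
rewrite qE; apply: PM => //; first exact: qD pr (pdiv_dvd q).
apply: IHq; first by rewrite qE -{1}(muln1 m) ltn_pmul2l ?prime_gt1.
by split=> // l l_pr lm; apply: qD => //; rewrite qE dvdn_mulr.
Qed.

(** Frobenius is additive on commuting elements, and a division ring has no nonzero nilpotents. *)
Lemma char_number_expr_inj q (u v : D) : char_number q -> u * v = v * u ->
  u ^+ q = v ^+ q -> u = v.
Proof.
move=> cq uv; move: q cq; apply: char_number_ind => [|m l l_pr l0 IHm].
  by rewrite !expr1.
rewrite !exprM => eqml; apply: IHm; apply/eqP; rewrite -subr_eq0; apply/negPn/negP.
move/(divring_expr_neq0 hD l)/eqP; apply.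
have pl : l \in [pchar D] by rewrite inE l_pr l0 eqxx.
rewrite -(pFrobenius_autE pl) pFrobenius_autB_comm ?pFrobenius_autE ?eqml ?subrr //.
by apply/commrX/commr_sym/commrX.
Qed.

Lemma exprVconj (g x : D) n : g != 0 -> (g * x * g^-1) ^+ n = g * x ^+ n * g^-1.
Proof.
move=> /hD Ug; elim: n => [|n IHn]; first by rewrite !expr0 mulr1 mulrV.
by rewrite !exprS IHn !mulrA mulrVK.
Qed.

Lemma conj_eq (g x y : D) : g != 0 -> (g * x * g^-1 = y) <-> (g * x = y * g).
Proof.
by move=> /hD Ug; split=> [<-|->]; rewrite ?mulrVK // mulrK.
Qed.

Variables (E R : D -> Prop) (pi : D).
Hypotheses (hE : is_divsubring E) (oR : adic_order E R pi).
Let hE' := divsubring_subring hE.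
Let hR := adic_subring oR.
Let Rpi := adic_mem oR.
Let RE := adic_sub oR.

Let piC n y : E y -> pi ^+ n * y = y * pi ^+ n.
Proof. by move=> Ey; apply/esym/commrX/esym; apply: (adic_comm oR). Qed.

Let Rpin n : R (pi ^+ n).
Proof. exact: subringX. Qed.

Lemma adic_absorb_seq (L : seq D) : (forall y, y \in L -> E y) ->
  exists m, forall y, y \in L -> R (pi ^+ m * y).
Proof.
elim: L => [|x L IHL] LE; first by exists 0%N.
have /IHL [m mL] : forall y, y \in L -> E y by move=> y Ly; apply: LE; rewrite inE Ly orbT.
have [n nx] := adic_absorb oR (LE _ (mem_head x L)).
exists (m + n)%N => y; rewrite inE => /predU1P[->|/mL].
  exact: adic_absorbW oR (leq_addl _ _) nx.
exact: adic_absorbW oR (leq_addr _ _).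
Qed.

(** If the element were zero, 1 would be divisible by every [pi ^+ j]. A geometric series would
    require completeness; instead some [pi ^+ m * v] is in [R], and [v = 1 - pi * X * v] lowers [m]
    to zero. *)
Lemma adic_unit X : R X -> 1 + pi * X != 0 /\ R (1 + pi * X)^-1.
Proof.
move=> RX; have gN0 : 1 + pi * X != 0.
  apply/eqP => g0; have /eqP := oner_neq0 D; apply; apply: (adic_sep oR) => j.
  exists ((- X) ^+ j); split; first by apply: subringX => //; apply: subringN.
  rewrite -exprMn_comm; last by apply: (adic_comm oR); apply: RE; apply: subringN.
  have <- : 1 = pi * - X; last by rewrite expr1n.
  by apply/eqP; rewrite mulrN -addr_eq0 g0.
split=> //; set v := _^-1.
have Ev : E v.
  apply: divsubring_inv => //; apply: subringD => //; first by case: hE.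
  by apply: RE; apply: subringM.
have vE : v = 1 - pi * X * v.
  by apply/eqP; rewrite eq_sym subr_eq -[X in _ == X + _]mul1r -mulrDl mulrV ?hD.
have [m] := adic_absorb oR Ev; elim: m => [|m IHm]; first by rewrite expr0 mul1r.
move=> Rm; apply: IHm; rewrite vE mulrBr mulr1 !mulrA -exprSr (piC _ (RE RX)) -mulrA.
by case: hR => _ RB RM; apply: (RB); last apply: (RM).
Qed.

Definition adic_unipotent z := exists X, R X /\ z = 1 + pi * X.

Lemma adic_unipotent1 : adic_unipotent 1.
Proof. by exists 0; rewrite mulr0 addr0; split=> //; apply: subring0. Qed.

Lemma adic_unipotentM z t : adic_unipotent z -> adic_unipotent t -> adic_unipotent (z * t).
Proof.
move=> [X [RX ->]] [Y [RY ->]]; exists (X + Y + X * (pi * Y)); split.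
  by do ?[apply: subringD => // | apply: subringM => //].
by rewrite mulrDl mul1r !mulrDr mulr1 !mulrA -!addrA; congr (1 + _); rewrite addrCA.
Qed.

Lemma adic_unipotentX z n : adic_unipotent z -> adic_unipotent (z ^+ n).
Proof.
move=> Uz; elim: n => [|n IHn]; first exact: adic_unipotent1.
by rewrite exprS; apply: adic_unipotentM.
Qed.

Let ideal j x := exists s, R s /\ x = pi ^+ j * s.

Let idealD j x y : ideal j x -> ideal j y -> ideal j (x + y).
Proof.
by move=> [s [Rs ->]] [t [Rt ->]]; exists (s + t); rewrite mulrDr; split=> //; apply: subringD.
Qed.

Let idealMl j x r : R r -> ideal j x -> ideal j (r * x).
Proof.
move=> Rr [s [Rs ->]]; exists (r * s); split; first exact: subringM.
by rewrite !mulrA (piC _ (RE Rr)).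
Qed.

Let idealMr j x r : R r -> ideal j x -> ideal j (x * r).
Proof.
by move=> Rr [s [Rs ->]]; exists (s * r); rewrite mulrA; split=> //; apply: subringM.
Qed.

Let idealX j X Y i : R X -> R Y -> ideal j (X - Y) -> ideal j (X ^+ i - Y ^+ i).
Proof.
move=> RX RY IXY; elim: i => [|i IHi].
  by rewrite subrr; exists 0; rewrite mulr0; split=> //; apply: subring0.
have -> : X ^+ i.+1 - Y ^+ i.+1 = X * (X ^+ i - Y ^+ i) + (X - Y) * Y ^+ i.
  by rewrite !exprS mulrBr mulrBl addrA subrK.
by apply: idealD; [apply: idealMl|apply: idealMr => //; apply: subringX].
Qed.

(* After division by [l pi], the binomial expansion reads
   [X - Y = - pi * (combination of the X^i - Y^i)]; iterating, [X - Y] lies in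
   every [pi^j R].  [adic_prime] makes the term [pi^l] divisible by [l]. *)
Lemma adic_root_prime l z t : prime l -> l%:R != 0 :> D ->
  adic_unipotent z -> adic_unipotent t -> z ^+ l = t ^+ l -> z = t.
Proof.
move=> l_pr lN0 [X [RX ->]] [Y [RY ->]] eqXY.
suff /eqP XY : X - Y = 0 by move: XY; rewrite subr_eq0 => /eqP ->.
have [n lE] : exists n, l = n.+2 by exists (l - 2)%N; have := prime_gt1 l_pr; lia.
(* [r i] is the binomial coefficient of degree [i.+2] divided by [l * pi ^+ 2]; degrees 0 and 1 are
   kept apart. The last index uses [adic_prime], the others that [l] divides the binomial. The value
   0 only fills indices out of range. *)
have /choice [r rP] i : exists r, (i < n.+1)%N ->
    R r /\ pi ^+ i.+2 *+ 'C(l, i.+2) = l%:R * (pi * (pi * r)).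
  case: (ltnP i n.+1) => [i_n|_]; last by exists 0.
  case: (eqVneq i n) => [->|iNn].
    have [r [Rr rE]] := adic_prime oR l_pr lN0; exists r => _; split=> //.
    have -> : pi ^+ n.+2 = pi * (pi * pi ^+ (l - 2)) by rewrite -!exprS lE subn2.
    by rewrite -lE binn mulr1n rE !mulr_natl !mulrnAr.
  have /dvdnP [m mE] : (l %| 'C(l, i.+2))%N by apply: prime_dvd_bin => //; lia.
  exists (pi ^+ i *+ m) => _; split.
    by rewrite -mulr_natr; apply: subringM => //; apply: subring_nat.
  by rewrite mE mulrnA !mulrnAr -!exprS mulr_natl mulrnAC.
subst l; have rel : X - Y = - (pi * \sum_(i < n.+1) r i * (X ^+ i.+2 - Y ^+ i.+2)).
  have exp Z : R Z -> (1 + pi * Z) ^+ n.+2 =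
      1 + n.+2%:R * (pi * (Z + pi * \sum_(i < n.+1) r i * Z ^+ i.+2)).
    move=> RZ; rewrite addrC exprD1n big_ord_recl [X in _ + X = _]big_ord_recl /=.
    rewrite expr0 bin0 bin1 expr1 mulr1n.
    congr (_ + _); rewrite !mulrDr mulr_natl; congr (_ + _).
    rewrite !mulr_sumr; apply: eq_bigr => i _; have [Rr rE] := rP i (ltn_ord i).
    have -> : bump 0 (bump 0 i) = i.+2 by [].
    rewrite exprMn_comm; last by apply: adic_comm oR _ (RE RZ).
    by rewrite -mulrnAl rE !mulrA.
  move: eqXY; rewrite !exp // => /addrI/(mulrI (hD lN0))/(mulrI (hD (adic_neq0 oR))) eqs.
  apply/eqP; rewrite -addr_eq0.
  under eq_bigr => i _ do rewrite mulrBr.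
  by rewrite sumrB mulrBr addrACA eqs -opprD subrr.
apply: (adic_sep oR); elim=> [|j [s [Rs IHj]]].
  by exists (X - Y); rewrite mul1r; split=> //; case: hR => _ RB _; apply: RB.
have : ideal j (\sum_(i < n.+1) r i * (X ^+ i.+2 - Y ^+ i.+2)).
  apply: big_ind => [|x y|i _].
  - by exists 0; rewrite mulr0; split=> //; apply: subring0.
  - exact: idealD.
  - by apply: idealMl; [have [] := rP i (ltn_ord i)|apply: idealX => //; exists s].
move=> [t0 [Rt tE]]; exists (- t0); split; first exact: subringN.
by rewrite rel tE mulrN mulrA -exprS.
Qed.

(** Primes that are nonzero in [D] are cancelled from [n] one by one with [adic_root_prime]; what
    remains is the [q] sought. *)
Lemma adic_root n z t : (0 < n)%N -> adic_unipotent z -> adic_unipotent t ->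
  z ^+ n = t ^+ n -> exists q, char_number q /\ z ^+ q = t ^+ q.
Proof.
move=> n0 Uz Ut; elim/ltn_ind: n n0 => n IHn n0 eqn.
case: (pselect (exists l, [/\ prime l, (l %| n)%N & l%:R != 0 :> D])) => [[l [l_pr]]|N].
  move=> /dvdnP [m nE] lN0.
  have m0 : (0 < m)%N by case: m nE => // nE; rewrite nE in n0.
  apply: (IHn m) => //; first by rewrite nE -{1}(muln1 m) ltn_pmul2l ?prime_gt1.
  apply: (adic_root_prime l_pr lN0); [exact: adic_unipotentX|exact: adic_unipotentX|].
  by rewrite -!exprM -nE.
exists n; split=> //; split=> // l l_pr ln; apply/eqP/negPn/negP => lN0.
by apply: N; exists l.
Qed.

Lemma adic_root_comm n z t : (0 < n)%N -> adic_unipotent z -> adic_unipotent t ->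
  z * t = t * z -> z ^+ n = t ^+ n -> z = t.
Proof.
move=> n0 Uz Ut zt eqn; have [q [cq eqq]] := adic_root n0 Uz Ut eqn.
exact: char_number_expr_inj cq zt eqq.
Qed.

(* [s = 1 + d] as operators, [s ^+ l] is the identity on [x] and the middle
   binomials vanish, hence [d ^+ l] kills [x]; the last nonzero iterates of [d]
   provide [y]. *)
Lemma conj_shift l w x : prime l -> l%:R = 0 :> D -> w != 0 -> E w -> E x ->
  w ^+ l * x = x * w ^+ l -> w * x <> x * w ->
  exists y, E y /\ w * y * w^-1 = y + 1.
Proof.
move=> l_pr l0 wN0 Ew Ex wl wx; have Uw := hD wN0.
pose s y := w * y * w^-1; pose d i := iter i (fun y => s y - y) x.
have sd i : s (d i) = d i + d i.+1 by rewrite /d /= addrC subrK.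
have sn m : iter m s x = \sum_(i < m.+1) d i *+ 'C(m, i).
  elim: m => [|m IHm]; first by rewrite big_ord_recl big_ord0 bin0 mulr1n addr0.
  rewrite iterS IHm /s mulr_sumr mulr_suml.
  under eq_bigr => i _ do rewrite mulrnAr mulrnAl -/(s (d i)) sd mulrnDl.
  rewrite big_split /= [X in X + _]big_ord_recl [RHS]big_ord_recl /= !bin0 -addrA.
  congr (_ + _); rewrite [RHS](eq_bigr (fun i : 'I_m.+1 => d i.+1 *+ 'C(m, i.+1) + d i.+1 *+ 'C(m, i))).
    by rewrite big_split /= [X in _ = X + _]big_ord_recr /= (bin_small (ltnSn m)) mulr0n addr0.
  by move=> i _; rewrite -mulrnDr -binS.
have sx m : iter m s x = w ^+ m * x * w^-1 ^+ m.
  elim: m => [|m IHm]; first by rewrite !expr0 mul1r mulr1.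
  by rewrite iterS IHm /s exprS exprSr !mulrA.
have dl : d l = 0.
  have := sn l; rewrite sx wl exprVn mulrK ?unitrX //.
  rewrite big_ord_recr (bigD1 (Ordinal (prime_gt0 l_pr))) //= bin0 binn !mulr1n.
  rewrite big1 ?addr0 => [|i i0]; first by rewrite -{1}[x]addr0 => /addrI.
  have /dvdnP [m ->] : (l %| 'C(l, i))%N.
    by apply: prime_dvd_bin => //; rewrite lt0n ltn_ord andbT; apply: i0.
  by rewrite mulrnA -mulr_natl l0 mul0r.
have exd : exists i, d i == 0 by exists l; rewrite dl.
have Ed i : E (d i).
  elim: i => [|i IHi] //; rewrite /d iterS -/(d i); case: (hE') => _ EB _; apply: (EB) => //.
  by apply: subringM => //; [apply: subringM|apply: divsubring_inv].
(* A first zero at index 0 or 1 would make [x] zero or commute with [w]. Otherwise [s] fixes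
   [d m.+1] and adds it to [d m], so their quotient is shifted by 1. *)
case: (ex_minnP exd) => [[|[|m]]] dm dmin.
- have x0 : x = 0 := eqP dm; by case: wx; rewrite x0 mul0r mulr0.
- case: wx; apply/(conj_eq _ _ wN0)/eqP; rewrite -subr_eq0; exact: dm.
have cN0 : d m.+1 != 0 by apply/negP => /dmin; rewrite ltnn.
have sc : w * d m.+1 * w^-1 = d m.+1 by have := sd m.+1; rewrite (eqP dm) addr0.
exists (d m * (d m.+1)^-1); split; first by apply: subringM => //; apply: divsubring_inv.
move/(conj_eq _ _ wN0): sc => sc.
have -> : w * (d m * (d m.+1)^-1) * w^-1 = s (d m) * (d m.+1)^-1.
  have cV : w * (d m.+1)^-1 = (d m.+1)^-1 * w by apply: commrV.
  have cVV : (d m.+1)^-1 * w^-1 = w^-1 * (d m.+1)^-1 by apply/esym/commr_sym/commrV/commr_sym.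
  by rewrite /s -!mulrA cVV.
by rewrite sd mulrDl mulrV ?hD.
Qed.

(** * Normal subgroups whose elements in [E] have powers central in [E] *)

Variable N : D -> Prop.
Hypothesis hN : is_normal_subgroup_units N.
Hypothesis rad : forall x, N x -> E x ->
  exists n, (0 < n)%N /\ forall y, E y -> x ^+ n * y = y * x ^+ n.

Let NM x y : N x -> N y -> N (x * y). Proof. by case: hN => _ _ H _ _; apply: H. Qed.
Let NN0 x : N x -> x != 0. Proof. by case: hN => H _ _ _ _; apply: H. Qed.
Let NV x : N x -> N x^-1. Proof. by case: hN => _ _ _ H _; apply: H. Qed.
Let NJ g x : g != 0 -> N x -> N (g * x * g^-1).
Proof.
move=> gN0 Nx; case: hN => _ _ _ _ /(_ x g^-1 Nx); rewrite invrK; apply.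
by apply/eqP => g0; have := hD gN0; rewrite -unitrV g0 unitr0.
Qed.
Let NX x n : N x -> N (x ^+ n).
Proof.
move=> Nx; elim: n => [|n IHn]; first by case: hN.
by rewrite exprS; apply: NM.
Qed.

(** Otherwise [w] shifts some [y] by 1, hence shifts [g = 1 + t * y] by [t]. The commutator
    [u = 1 + t / g] and its conjugate [1 + t / (g + t)] commute and share a central power, so they
    coincide, which forces [t = 0]. *)
Lemma radical_inseparable_central l w : prime l -> l%:R = 0 :> D -> N w -> E w ->
  (forall y, E y -> w ^+ l * y = y * w ^+ l) -> forall x, E x -> w * x = x * w.
Proof.
move=> l_pr l0 Nw Ew wl x Ex; case: (pselect (w * x = x * w)) => // wx.
have wN0 := NN0 Nw; have Uw := hD wN0.
have [y [Ey wy]] := conj_shift l_pr l0 wN0 Ew Ex (wl _ Ex) wx.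
have [m Rm] := adic_absorb oR Ey.
pose t := pi ^+ m.+1; pose g := 1 + t * y; pose g' := g + t.
have Et : E t by apply/RE/Rpin.
have tC z : E z -> t * z = z * t by apply: piC.
have gE : g = 1 + pi * (pi ^+ m * y) by rewrite /g /t exprS mulrA.
have g'E : g' = 1 + pi * (pi ^+ m * y + pi ^+ m) by rewrite /g' gE mulrDr addrA -exprS.
have [gN0 RgV] : g != 0 /\ R g^-1 by rewrite gE; apply: adic_unit.
have [g'N0 Rg'V] : g' != 0 /\ R g'^-1.
  by rewrite g'E; apply: adic_unit; apply: subringD.
have Eg : E g by apply: subringD; [|case: hE|apply: subringM].
have wg : w * g * w^-1 = g'.
  rewrite /g mulrDr mulr1 mulrDl mulrV // mulrA -(tC w) // -!mulrA (mulrA w) wy.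
  by rewrite mulrDr mulr1 addrA.
pose u := 1 + t * g^-1.
have uE : u = w * (g * w^-1 * g^-1) by rewrite !mulrA wg /g' mulrDl mulrV ?hD.
have wu : w * u * w^-1 = 1 + t * g'^-1.
  rewrite /u mulrDr mulr1 mulrDl mulrV // mulrA -(tC w) // -!mulrA; congr (1 + t * _).
  have Ug := hD gN0; have UwV : w^-1 \is a GRing.unit by rewrite unitrV.
  by rewrite -wg invrM ?(invrM Uw Ug) ?invrK // unitrMl.
have Nu : N u by rewrite uE; apply: NM => //; apply: NJ => //; apply: NV.
have Eu : E u.
  apply: subringD => //; first by case: hE.
  by apply: subringM => //; apply: RE.
have [n [n0 un]] := rad Nu Eu.
have ug : w * u * w^-1 = u.
  have cgV : g^-1 * g'^-1 = g'^-1 * g^-1.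
    apply/commrV/commr_sym/commrV/commr_sym; apply: commrD => //.
    by apply/esym/tC.
  apply: (@adic_root_comm n) => //.
  - by exists (pi ^+ m * g'^-1); rewrite wu /t exprS mulrA; split=> //; apply: subringM.
  - by exists (pi ^+ m * g^-1); rewrite /u /t exprS mulrA; split=> //; apply: subringM.
  - rewrite wu /u; apply/commr_sym/commrD; first exact: commr1.
    apply/commr_sym/commrD; first exact: commr1.
    have EgV := RE RgV; have Eg'V := RE Rg'V.
    by rewrite /GRing.comm -!mulrA (mulrA _ t) -(tC g'^-1) // (mulrA _ t) -(tC g^-1) // -!mulrA cgV.
  - by rewrite exprVconj //; apply/conj_eq => //; rewrite un.
move: ug; rewrite wu => /addrI/(mulrI (hD (divring_expr_neq0 hD _ (adic_neq0 oR))))/invr_inj.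
rewrite /g' -{2}[g]addr0 => /addrI/eqP.
by rewrite (negPf (divring_expr_neq0 hD _ (adic_neq0 oR))).
Qed.

Lemma radical_char_power_central q w : char_number q -> N w -> E w ->
  (forall y, E y -> w ^+ q * y = y * w ^+ q) -> forall x, E x -> w * x = x * w.
Proof.
move=> cq Nw Ew; move: q cq; apply: char_number_ind => // m l l_pr l0 IHm wl.
apply: IHm; apply: (radical_inseparable_central l_pr l0).
- exact: NX.
- exact: subringX.
- by move=> y Ey; rewrite -exprM wl.
Qed.

Lemma radical_comm a b : N a -> E a -> E b ->
  (forall x, E x -> x * a = a * x -> x * b = b * x -> forall y, E y -> x * y = y * x) ->
  a * b = b * a.
Proof.
move=> Na Ea Eb gen; have aN0 := NN0 Na; have Ua := hD aN0.
have [->|bN0] := eqVneq b 0; first by rewrite mulr0 mul0r.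
have EM x y : E x -> E y -> E (x * y) by apply: subringM.
have EV x : E x -> E x^-1 by apply: divsubring_inv.
have E1 : E 1 by case: hE.
pose kap := b * a - a * b.
have Ek : E kap by case: (hE') => _ EB _; apply: (EB); apply: EM.
(* The conjugators of [z]: 1 for [z] itself, [a] and [b] because commuting with both means being
   central in [E]. *)
pose hs := [:: 1; a; b].
have hsP h : h \in hs -> E h /\ h != 0.
  by rewrite !inE => /or3P[] /eqP->; rewrite ?oner_neq0.
have [m Rm] : exists m, forall y, y \in b :: [seq h * kap | h <- hs] ++ [seq a^-1 * h^-1 | h <- hs] ->
    R (pi ^+ m * y).
  apply: adic_absorb_seq => y; rewrite inE mem_cat => /or3P[/eqP->//|/mapP[h /hsP [Eh _] ->]|].
    exact: EM.
  by move=> /mapP[h /hsP [Eh _] ->]; apply: (EM); apply: EV.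
(* One factor [pi ^+ m] absorbs [h * kap], the other [a^-1 * h^-1], and the extra [pi] places the
   conjugates of [z] in [1 + pi R]. *)
pose t := pi ^+ (m + m).+1; pose g := 1 + t * b.
have Et : E t by apply/RE/Rpin.
have tC z : E z -> t * z = z * t by apply: piC.
have tN0 : t != 0 := divring_expr_neq0 hD _ (adic_neq0 oR).
have [gN0 RgV] : g != 0 /\ R g^-1.
  rewrite /g /t exprS exprD -!mulrA; apply: adic_unit.
  by apply: subringM => //; apply: Rm; rewrite mem_head.
have Eg : E g by apply: subringD => //; apply: EM.
have gag : g * a - a * g = t * kap.
  rewrite /g mulrDl mul1r mulrDr mulr1 opprD addrACA subrr add0r /kap mulrBr.
  by rewrite !mulrA (tC a).
pose z := g * a * g^-1 * a^-1.
have zE : z = 1 + t * kap * g^-1 * a^-1.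
  by rewrite -gag mulrBl mulrK ?hD // mulrBl mulrV // addrC subrK.
have Nz : N z by apply: NM; [apply: NJ|apply: NV].
have Ez : E z by do ![apply: (EM) => //]; apply: EV.
have ga : g * a = z * a * g.
  rewrite /z -[in RHS]mulrA -[in RHS]mulrA (mulrA a^-1) mulVr // mul1r -mulrA mulVr ?hD //.
  by rewrite mulr1.
clearbody z.
have Uz h : h \in hs -> adic_unipotent (h * z * h^-1).
  move=> hh; have [Eh hN0] := hsP h hh; have Uh := hD hN0.
  pose v := pi ^+ m * (h * kap) * g^-1.
  have Rv : R v.
    by apply: subringM => //; apply: Rm; rewrite inE mem_cat (map_f (fun h => h * kap)) ?orbT.
  exists (v * (pi ^+ m * (a^-1 * h^-1))); split.
    apply: subringM => //; apply: Rm.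
    by rewrite inE mem_cat (map_f (fun h => a^-1 * h^-1)) ?orbT.
  rewrite zE mulrDr mulr1 mulrDl mulrV //; congr (1 + _).
  rewrite (mulrA v) -(piC m (RE Rv)) /v !mulrA -(tC h) //.
  by rewrite /t exprS exprD -!mulrA.
have [n [n0 zn]] := rad Nz Ez.
have Uz1 : adic_unipotent z by have := Uz 1; rewrite invr1 mulr1 mul1r; apply; rewrite mem_head.
(* As [z ^+ n] is central, [z] and its conjugate by [h] have the same [n]-th power. *)
have root h : h \in hs -> exists q, char_number q /\ z ^+ q * h = h * z ^+ q.
  move=> hh; have [Eh hN0] := hsP h hh.
  have [|q [cq zq]] := adic_root n0 (Uz h hh) Uz1.
    by rewrite exprVconj //; apply/conj_eq => //; rewrite zn.
  exists q; split=> //; move: zq; rewrite exprVconj // => /(conj_eq _ _ hN0) ->.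
  by [].
have [|qa [[qa0 cqa] zqa]] := root a; first by rewrite !inE eqxx orbT.
have [|qb [[qb0 cqb] zqb]] := root b; first by rewrite !inE eqxx !orbT.
have cq : char_number (qa * qb).
  split=> [|l l_pr]; first by rewrite muln_gt0 qa0.
  by rewrite Euclid_dvdM // => /orP[/cqa|/cqb]; apply.
have zC : forall y, E y -> z * y = y * z.
  apply: (radical_char_power_central cq) => //; apply: gen.
  - exact: subringX.
  - by rewrite exprM; apply/esym/commrX.
  - by rewrite mulnC exprM; apply/esym/commrX.
(* Conjugation by [g] multiplies [a] by the now central [z]; a central power of [a] then gives
   [z ^+ k = 1]. *)
have gan k : g * a ^+ k = z ^+ k * a ^+ k * g.
  elim: k => [|k IHk]; first by rewrite !expr0 !mul1r mulr1.
  rewrite !exprSr mulrA IHk -mulrA ga -!mulrA; congr (_ * _).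
  by rewrite !mulrA -(zC (a ^+ k)) //; apply: subringX.
have [k [k0 ak]] := rad Na Ea.
have zk : z ^+ k = 1.
  have Uag : a ^+ k * g \is a GRing.unit by rewrite unitrMl ?unitrX ?hD.
  by apply: (mulIr Uag); rewrite mulrA -gan mul1r ak.
have z1 : z = 1.
  apply: (adic_root_comm k0) => //; first exact: adic_unipotent1.
    by rewrite mul1r mulr1.
  by rewrite expr1n.
apply/esym/eqP; rewrite -subr_eq0 -/kap; apply/eqP.
by move: gag; rewrite ga z1 mul1r subrr => /esym/(divring_mul_eq0 hD) [/eqP|//]; rewrite (negPf tN0).
Qed.
End Roots.

(** * Powers commuting with a given element, and the conclusion *)

(* If [w], [y w y^-1 = u] and [(1+y) w (1+y)^-1 = v] lie in [K], then
   [(u - v) y = v - w], so [y] lies in [K] unless [u = v = w]. *)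
Lemma radical_power_comm (D : unitRingType) (K N : D -> Prop) :
  is_division_ring D -> is_divsubring K -> (exists x : D, ~ K x) ->
  is_normal_subgroup_units N -> radical_over N K ->
  forall x y, N x -> exists n, (0 < n)%N /\ x ^+ n * y = y * x ^+ n.
Proof.
move=> hD hK [y0 Ky0] [NN0 _ _ _ NJ] rad x y Nx.
have hK' := divsubring_subring hK.
have conjK g : g != 0 -> exists n, (0 < n)%N /\ K (g * x ^+ n * g^-1).
  move=> gN0; have gVN0 : g^-1 != 0.
    by apply/eqP => g0; have := hD _ gN0; rewrite -unitrV g0 unitr0.
  have [n [n0]] := rad _ (NJ _ _ Nx gVN0); rewrite invrK exprVconj // => Kn.
  by exists n.
have out z : ~ K z -> exists n, (0 < n)%N /\ x ^+ n * z = z * x ^+ n.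
  move=> Kz.
  have zN0 : z != 0 by apply/eqP => z0; apply: Kz; rewrite z0; apply: subring0.
  have z1N0 : 1 + z != 0.
    apply/eqP => /eqP; rewrite addrC addr_eq0 => /eqP z1; apply: Kz.
    by rewrite z1; apply: subringN => //; case: hK.
  have [n1 [n10 Kn1]] := rad _ Nx.
  have [n2 [n20 Kn2]] := conjK z zN0; have [n3 [n30 Kn3]] := conjK _ z1N0.
  have KX g m n : g != 0 -> K (g * x ^+ m * g^-1) -> K (g * x ^+ (m * n) * g^-1).
    by move=> gN0 Km; rewrite exprM -exprVconj //; apply: subringX.
  pose n := (n1 * n2 * n3)%N; exists n; split; first by rewrite !muln_gt0 n10 n20.
  pose w := x ^+ n; pose u := z * w * z^-1; pose v := (1 + z) * w * (1 + z)^-1.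
  have Kw : K w by rewrite /w /n -mulnA exprM; apply: subringX.
  have Ku : K u by rewrite /u /w /n (mulnC n1) -mulnA; apply: (KX).
  have Kv : K v by rewrite /v /w /n mulnC; apply: (KX).
  have zw : z * w = u * z by apply/(conj_eq hD).
  have zw1 : (1 + z) * w = v * (1 + z) by apply/(conj_eq hD).
  have uvz : (u - v) * z = v - w.
    move: zw1; rewrite mulrDl mul1r mulrDr mulr1 => /eqP zw1.
    by apply/eqP; rewrite mulrBl -zw subr_eq addrAC -(eqP zw1) addrAC subrr add0r.
  have uv : u = v.
    apply/eqP; rewrite -subr_eq0; apply/negPn/negP => uvN0; apply: Kz.
    rewrite -(mulKr (hD _ uvN0) z) uvz; apply: subringM => //.
      by apply: divsubring_inv => //; case: hK' => _ KB _; apply: KB.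
    by case: hK' => _ KB _; apply: KB.
  move: uvz; rewrite uv subrr mul0r => /esym/eqP; rewrite subr_eq0 => /eqP vw.
  by rewrite -/w zw uv vw.
case: (pselect (K y)) => [Ky|]; last exact: out.
(* For [y] in [K], both [y0] and [y + y0] lie outside [K]; a common power of [x] commutes with both,
   hence with their difference [y]. *)
have [n [n0 ny]] := out _ Ky0.
have [|m [m0 my]] := out (y + y0).
  by move=> Kyy; apply: Ky0; rewrite -(addKr y y0) addrC; case: hK' => _ KB _; apply: KB.
exists (n * m)%N; rewrite muln_gt0 n0 m0; split=> //.
have c1 : x ^+ (n * m) * y0 = y0 * x ^+ (n * m) by rewrite exprM; apply/esym/commrX.
have c2 : x ^+ (n * m) * (y + y0) = (y + y0) * x ^+ (n * m).
  by rewrite mulnC exprM; apply/esym/commrX.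
by move: c2; rewrite mulrDl mulrDr c1 => /addIr.
Qed.

Theorem theorem6p6 (D : unitRingType) (K N : D -> Prop) :
  is_division_ring D ->
  weakly_locally_finite D ->
  is_divsubring K -> (exists x : D, ~ K x) ->
  is_normal_subgroup_units N ->
  radical_over N K ->
  forall x, N x -> ring_center x.
Proof.
move=> hD wlf hK pK hN rad a Na b.
have powC := radical_power_comm hD hK pK hN rad.
pose E := divsubring_gen [:: a; b].
have hE : is_divsubring E := divsubring_gen_divsubring _.
have Ea : E a by apply: mem_divsubring_gen; rewrite mem_head.
have Eb : E b by apply: mem_divsubring_gen; rewrite !inE eqxx orbT.
have gen x : x * a = a * x -> x * b = b * x -> forall y, E y -> x * y = y * x.
  by move=> xa xb; apply: comm_divsubring_gen => s; rewrite !inE => /orP[] /eqP ->.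
case: (finite_or_adic_fin_dim hD (wlf [:: a; b])) => [[s Es]|[R [pi oR]]].
  exact: (finite_divsubring_comm hD hE Es).
apply: (radical_comm hD hE oR hN) => // [x Nx Ex|x _]; last exact: gen.
have [n [n0 na]] := powC x a Nx; have [m [m0 mb]] := powC x b Nx.
(* This power commutes with both generators [a] and [b], hence with all of [E]. *)
exists (n * m)%N; rewrite muln_gt0 n0; split=> //; apply: gen.
  by rewrite exprM; apply/esym/commrX.
by rewrite mulnC exprM; apply/esym/commrX.
Qed.
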